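(* Fix a congruence subgroup $\Gamma\subset\mathrm{SL}(2,\mathbb{Z})$, and let $\mathcal{A}(\Gamma)$ be the vector space of all Hecke operator forms of level $\Gamma$. 1. For $F^1,F^2\in\mathcal{A}(\Gamma)$, the operation $$(F^1*F^2)_\alpha:=\sum_{\beta\in\Gamma\backslash G^+(\mathbb{Q})}F^1_\beta\cdot F^2_{\alpha\beta^{-1}}|\beta$$ turns $\mathcal{A}(\Gamma)$ into an associative algebra. 2. The equality $$F*f:=\sum_{\alpha\in\Gamma\backslash G^+(\mathbb{Q})}F_\alpha\cdot f|\alpha$$ endows $\mathcal{M}(\Gamma)$ with the structure of an $\mathcal{A}(\Gamma)$-module. 3. The cuspidal Hecke operator forms of level $\Gamma$ form an ideal $\mathcal{A}^0(\Gamma)$ of $\mathcal{A}(\Gamma)$; the subspace $\mathcal{M}^0(\Gamma)$ is a submodule of the $\mathcal{A}(\Gamma)$-module $\mathcal{M}(\Gamma)$, and $\mathcal{A}^0(\Gamma)$ maps $\mathcal{M}(\Gamma)$ to $\mathcal{M}^0(\Gamma)$.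
   Context: $G^+(\mathbb{Q})=\mathrm{GL}^+(2,\mathbb{Q})$ (positive determinant). For $\alpha=\begin{pmatrix}a&b\\c&d\end{pmatrix}\in\mathrm{GL}^+(2,\mathbb{R})$ and $f$ on the upper half-plane, $f|_k\alpha(z)=\det(\alpha)^{k/2}f\left(\frac{az+b}{cz+d}\right)(cz+d)^{-k}$; $f|\alpha$ means $k$ is the weight of $f$, extended linearly to sums of forms of different weights. $\mathcal{M}(\Gamma)=\bigoplus_{k\ge0}\mathcal{M}_k(\Gamma)$ is the graded algebra of modular forms for $\Gamma$ (weight $0$: constants) and $\mathcal{M}^0(\Gamma)$ the subspace of cusp forms; $\mathcal{M}=\bigcup_N\mathcal{M}(\Gamma(N))$ and $\mathcal{M}^0=\bigcup_N\mathcal{M}^0(\Gamma(N))$ are the modular, resp. cusp, forms of all levels. A Hecke operator form of level $\Gamma$ is a map $F:\Gamma\backslash G^+(\mathbb{Q})\to\mathcal{M}$, $\Gamma\alpha\mapsto F_\alpha$, with finite support such that $F_{\alpha\gamma}=F_\alpha|\gamma$ for all $\alpha\in G^+(\mathbb{Q})$, $\gamma\in\Gamma$. It is cuspidal if $F_\alpha\in\mathcal{M}^0$ for all $\alpha\in G^+(\mathbb{Q})$. *)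

(* Defs.v *)
From HB Require Import structures.
From mathcomp Require Import all_boot all_order all_algebra.
From mathcomp Require Import ring complex.
From mathcomp Require Import all_classical all_reals all_analysis.

Set Implicit Arguments.
Unset Strict Implicit.
Unset Printing Implicit Defensive.

Import Order.TTheory GRing.Theory Num.Theory.
Import numFieldNormedType.Exports.

Local Open Scope classical_set_scope.
Local Open Scope ring_scope.
Local Open Scope complex_scope.

Record GLpQ : Type := MkGLpQ { gl_mx :> 'M[rat]_2; gl_det : 0 < \det gl_mx }.

HB.instance Definition _ := [isSub for gl_mx].
HB.instance Definition _ := [Choice of GLpQ by <:].

Section GLpQ_group.

Lemma GLpQ_unit (a : GLpQ) : gl_mx a \in unitmx.
Proof. by rewrite unitmxE unitfE gt_eqF // gl_det. Qed.

Fact GLpQ_det1 : 0 < \det (1%:M : 'M[rat]_2).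
Proof. by rewrite det1. Qed.

Fact GLpQ_detM (a b : GLpQ) : 0 < \det (gl_mx a *m gl_mx b).
Proof. by rewrite det_mulmx mulr_gt0 // gl_det. Qed.

Fact GLpQ_detV (a : GLpQ) : 0 < \det (invmx a).
Proof. by rewrite det_inv invr_gt0 gl_det. Qed.

Definition GLpQ_one := MkGLpQ GLpQ_det1.
Definition GLpQ_mul a b := MkGLpQ (GLpQ_detM a b).
Definition GLpQ_inv a := MkGLpQ (GLpQ_detV a).

Fact GLpQ_mulA : associative GLpQ_mul.
Proof. by move=> a b c; apply/val_inj; rewrite /= mulmxA. Qed.

Fact GLpQ_mul1 : left_id GLpQ_one GLpQ_mul.
Proof. by move=> a; apply/val_inj; rewrite /= mul1mx. Qed.

Fact GLpQ_mulr1 : right_id GLpQ_one GLpQ_mul.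
Proof. by move=> a; apply/val_inj; rewrite /= mulmx1. Qed.

Fact GLpQ_mulV : left_inverse GLpQ_one GLpQ_inv GLpQ_mul.
Proof. by move=> a; apply/val_inj; rewrite /= mulVmx // GLpQ_unit. Qed.

Fact GLpQ_mulrV : right_inverse GLpQ_one GLpQ_inv GLpQ_mul.
Proof. by move=> a; apply/val_inj; rewrite /= mulmxV // GLpQ_unit. Qed.

HB.instance Definition _ := isGroup.Build GLpQ
  GLpQ_mulA GLpQ_mul1 GLpQ_mulr1 GLpQ_mulV GLpQ_mulrV.

End GLpQ_group.

Definition SL2Z : set GLpQ :=
  [set a | \det (gl_mx a) = 1 /\ exists m : 'M[int]_2, gl_mx a = map_mx intr m].

Definition GammaN (N : nat) : set GLpQ :=
  [set a | \det (gl_mx a) = 1 /\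
    exists m : 'M[int]_2, gl_mx a = 1%:M + N%:R *: map_mx intr m].

Definition congruence_subgroup (G : set GLpQ) : Prop :=
  [/\ G `<=` SL2Z,
      G 1%g,
      forall a b, G a -> G b -> G (a * b)%g,
      forall a, G a -> G (a^-1)%g
    & exists2 N : nat, (0 < N)%N & GammaN N `<=` G].

Lemma det_mx22 (F : comNzRingType) (A : 'M[F]_2) :
  \det A = A 0 0 * A 1 1 - A 0 1 * A 1 0.
Proof.
rewrite (expand_det_row _ 0) !big_ord_recl big_ord0 addr0 /cofactor !det_mx11 !mxE /=.
rewrite expr0 expr1 mul1r mulN1r mulrN.
by congr (A _ _ * A _ _ - A _ _ * A _ _); apply/val_inj.
Qed.

Section UpperHalfPlane.
Variable R : realType.

Record upper : Type := MkUpper { up_val :> R[i]; up_gt0 : 0 < complex.Im up_val }.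

HB.instance Definition _ := [isSub for up_val].
HB.instance Definition _ := [Choice of upper by <:].

Fact upper_i_gt0 : 0 < complex.Im ('i : R[i]).
Proof. exact: ltr01. Qed.

HB.instance Definition _ := isPointed.Build upper (MkUpper upper_i_gt0).

Definition glc (a : GLpQ) (i j : 'I_2) : R[i] := (ratr (gl_mx a i j))%:C.
Definition glnum (a : GLpQ) (z : R[i]) : R[i] := glc a 0 0 * z + glc a 0 1.
Definition gldenom (a : GLpQ) (z : R[i]) : R[i] := glc a 1 0 * z + glc a 1 1.

Fact mobius_gt0 (a : GLpQ) (z : upper) :
  0 < complex.Im (glnum a z / gldenom a z).
Proof.
have: 0 < ratr (\det (gl_mx a)) :> R by rewrite ltr0q gl_det.
case: z => -[x y] /= y0; rewrite det_mx22 rmorphB !rmorphM /= /glnum /gldenom /glc.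
set p := ratr _; set s := ratr _; set q := ratr _; set r := ratr _ => d0 /=.
rewrite !(mul0r, mulr0, addr0, subr0) /=.
have n0 : 0 < (r * x + s) ^+ 2 + (r * y + 0) ^+ 2.
  rewrite addr0 lt_neqAle addr_ge0 ?sqr_ge0 // andbT eq_sym paddr_eq0 ?sqr_ge0 //.
  rewrite !sqrf_eq0 mulf_eq0 (gt_eqF y0) orbF; apply/negP => /andP[h /eqP r0].
  by move: h d0; rewrite r0 mul0r add0r => /eqP ->; rewrite !mulr0 subr0 ltxx.
rewrite [ltRHS](_ : _ = (p * s - q * r) * y / ((r * x + s) ^+ 2 + (r * y + 0) ^+ 2)).
  by rewrite divr_gt0 // mulr_gt0.
by rewrite !addr0; field; rewrite -[r * y]addr0 gt_eqF.
Qed.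

Definition mobius (a : GLpQ) (z : upper) : upper := MkUpper (mobius_gt0 a z).

(* [insubd point] extends [f] to the plane by the constant [f point]; as the
   half-plane is open, the derivative at [z] does not depend on the extension. *)
Definition holomorphic (f : upper -> R[i]) : Prop :=
  forall z : upper,
    derivable (fun w : R[i]^o => f (insubd (point : upper) w) : R[i]^o) z 1.

Definition slash (k : nat) (f : upper -> R[i]) (a : GLpQ) : upper -> R[i] :=
  fun z => ((ratr (\det a) : R) `^ (k%:R / 2))%:C * f (mobius a z) * gldenom a z ^- k.

Definition bounded_at_ioo (f : upper -> R[i]) : Prop :=
  exists M B : R, forall z : upper, B <= complex.Im z -> `|f z| <= M%:C.

Definition vanishing_at_ioo (f : upper -> R[i]) : Prop :=
  forall e : R, 0 < e ->
    exists B : R, forall z : upper, B <= complex.Im z -> `|f z| <= e%:C.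

(* Holomorphy at the cusps is boundedness of every [SL2(Z)]-translate as
   [Im z -> +oo], cuspidality its vanishing there.  In weight [0] the forms are
   then the constants. *)
Record modular_form (G : set GLpQ) (k : nat) (f : upper -> R[i]) : Prop := {
  modular_holomorphic : holomorphic f;
  modular_invariant : forall g, G g -> slash k f g = f;
  modular_bounded : forall g, SL2Z g -> bounded_at_ioo (slash k f g) }.

Definition cusp_form (G : set GLpQ) (k : nat) (f : upper -> R[i]) : Prop :=
  modular_form G k f /\ forall g, SL2Z g -> vanishing_at_ioo (slash k f g).

(* A finite sum of functions [f_k], one for each weight [k], is encoded as the
   polynomial [\sum_k f_k *: 'X^k]: the ring operations are then those of the
   graded algebra, with ['X] recording the weight. *)
Definition gform : Type := {poly (upper -> R[i])}.
HB.instance Definition _ := GRing.ComNzRing.on gform.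

Definition gform_scale (c : R[i]) (f : gform) : gform :=
  (cst c : upper -> R[i]) *: (f : {poly (upper -> R[i])}).

Fact gform_scaleA c d f : gform_scale c (gform_scale d f) = gform_scale (c * d) f.
Proof. by rewrite /gform_scale scalerA. Qed.

Fact gform_scale1 : left_id 1 gform_scale.
Proof. by move=> f; rewrite /gform_scale scale1r. Qed.

Fact gform_scaleDr : right_distributive gform_scale +%R.
Proof. by move=> c f g; rewrite /gform_scale scalerDr. Qed.

Fact gform_scaleDl f : {morph gform_scale^~ f : c d / c + d}.
Proof. by move=> c d; rewrite /gform_scale -scalerDl. Qed.

HB.instance Definition _ := GRing.Zmodule_isLmodule.Build R[i] gform
  gform_scaleA gform_scale1 gform_scaleDr gform_scaleDl.

Definition gslash (f : gform) (a : GLpQ) : gform :=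
  \poly_(k < size f) slash k f`_k a.

Definition Mod (G : set GLpQ) : set gform :=
  [set f | forall k, modular_form G k f`_k].

Definition Mod0 (G : set GLpQ) : set gform :=
  [set f | forall k, cusp_form G k f`_k].

Definition Mod_all : set gform :=
  \bigcup_(N in [set N : nat | (0 < N)%N]) Mod (GammaN N).

Definition Mod0_all : set gform :=
  \bigcup_(N in [set N : nat | (0 < N)%N]) Mod0 (GammaN N).

End UpperHalfPlane.

Arguments Mod R G : clear implicits.
Arguments Mod0 R G : clear implicits.

Section Cosets.
Variable (G : set GLpQ).

Definition gcoset (a : GLpQ) : set GLpQ := [set (g * a)%g | g in G].

Variable V : nmodType.

Definition coset_summable (t : GLpQ -> V) : Prop :=
  (forall g a, G g -> t (g * a)%g = t a) /\
  finite_set (gcoset @` [set a | t a != 0]).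

(* [xget] picks a representative of each coset; for a [coset_summable] family
   the sum is finite and independent of these choices. *)
Definition coset_sum (t : GLpQ -> V) : V :=
  \sum_(C \in range gcoset) t (xget 1%g C).

End Cosets.

Section HeckeForms.
Variables (R : realType) (G : set GLpQ).

Record hecke_form (F : GLpQ -> gform R) : Prop := {
  hecke_form_modular : forall a, Mod_all (F a);
  hecke_form_coset : forall g a, G g -> F (g * a)%g = F a;
  hecke_form_finite : finite_set (gcoset G @` [set a | F a != 0]);
  hecke_form_slash : forall g a, G g -> F (a * g)%g = gslash (F a) g }.

Definition heckeA : set (GLpQ -> gform R) := [set F | hecke_form F].

Definition heckeA0 : set (GLpQ -> gform R) :=
  [set F | hecke_form F /\ forall a, Mod0_all (F a)].

Definition hecke_mul_term (F1 F2 : GLpQ -> gform R) (a b : GLpQ) : gform R :=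
  F1 b * gslash (F2 (a * b^-1)%g) b.

Definition hecke_mul (F1 F2 : GLpQ -> gform R) : GLpQ -> gform R :=
  fun a => coset_sum G (hecke_mul_term F1 F2 a).

Definition hecke_act_term (F : GLpQ -> gform R) (f : gform R) (a : GLpQ) : gform R :=
  F a * gslash f a.

Definition hecke_act (F : GLpQ -> gform R) (f : gform R) : gform R :=
  coset_sum G (hecke_act_term F f).

End HeckeForms.

Arguments heckeA R G : clear implicits.
Arguments heckeA0 R G : clear implicits.

Section AlgebraAndModules.
Variables (K : comNzRingType) (V W : lmodType K).

Definition subspace (U : lmodType K) (A : set U) : Prop :=
  A 0 /\ forall (c : K) (x y : U), A x -> A y -> A (c *: x + y).

(* [A] with the restriction of [mul] is an associative [K]-algebra with unit [e] *)
Record assoc_algebra (A : set V) (mul : V -> V -> V) (e : V) : Prop := {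
  alg_subspace : subspace A;
  alg_closed : forall x y, A x -> A y -> A (mul x y);
  alg_linearl : forall (c : K) x y z, A x -> A y -> A z ->
    mul (c *: x + y) z = c *: mul x z + mul y z;
  alg_linearr : forall (c : K) x y z, A x -> A y -> A z ->
    mul z (c *: x + y) = c *: mul z x + mul z y;
  alg_assoc : forall x y z, A x -> A y -> A z -> mul x (mul y z) = mul (mul x y) z;
  alg_unit : A e;
  alg_mul1 : forall x, A x -> mul e x = x;
  alg_mulr1 : forall x, A x -> mul x e = x }.

Record algebra_module (A : set V) (mul : V -> V -> V) (e : V)
    (M : set W) (act : V -> W -> W) : Prop := {
  mod_subspace : subspace M;
  mod_closed : forall x m, A x -> M m -> M (act x m);
  mod_linearl : forall (c : K) x y m, A x -> A y -> M m ->
    act (c *: x + y) m = c *: act x m + act y m;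
  mod_linearr : forall (c : K) x m n, A x -> M m -> M n ->
    act x (c *: m + n) = c *: act x m + act x n;
  mod_assoc : forall x y m, A x -> A y -> M m -> act x (act y m) = act (mul x y) m;
  mod_unit : forall m, M m -> act e m = m }.

Record algebra_ideal (A : set V) (mul : V -> V -> V) (I : set V) : Prop := {
  ideal_sub : I `<=` A;
  ideal_subspace : subspace I;
  ideal_left : forall x y, A x -> I y -> I (mul x y);
  ideal_right : forall x y, I x -> A y -> I (mul x y) }.

Record algebra_submodule (A : set V) (M : set W) (act : V -> W -> W)
    (M' : set W) : Prop := {
  submod_sub : M' `<=` M;
  submod_subspace : subspace M';
  submod_act : forall x m, A x -> M' m -> M' (act x m) }.

End AlgebraAndModules.

(* Main.v *)
Require Import Defs.
From HB Require Import structures.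
From mathcomp Require Import all_boot all_order all_algebra.
From mathcomp Require Import zify ring finmap complex.
From mathcomp Require Import all_classical all_reals all_analysis.

(* The slash operators form a right action of GL2+(Q), multiplicative for the
   graded product, so once F_alpha is left Gamma-invariant and satisfies
   F_(alpha gamma) = F_alpha | gamma, all the identities are reindexings of
   finite sums over cosets.  What uses modularity is that slashing by any alpha
   in GL2+(Q) preserves M and M^0: alpha^-1 Gamma(N) alpha contains a principal
   congruence subgroup, and alpha g = g' tau with g' in SL2(Z) and tau upper
   triangular, where tau preserves the behaviour at infinity.  The module
   M(Gamma) needs no separate treatment: F * f is the value of the product of F
   with the constant family f, which satisfies the same two conditions without
   having finite support. *)

Set Implicit Arguments.
Unset Strict Implicit.
Unset Printing Implicit Defensive.

Import Order.TTheory GRing.Theory Num.Theory.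
Import numFieldNormedType.Exports.

Local Open Scope classical_set_scope.
Local Open Scope ring_scope.
Local Open Scope complex_scope.

(** * Slash operators *)

Section Slash.
Variable R : realType.
Implicit Types (f g : upper R -> R[i]) (a b : GLpQ) (z : upper R) (k : nat).

(** As [0^-1 = 0], a zero denominator would give a Moebius image of imaginary part zero. *)
Lemma gldenom_neq0 a z : gldenom a z != 0.
Proof.
have := mobius_gt0 a z; apply: contraTneq => ->.
by rewrite invr0 mulr0 ltxx.
Qed.

Lemma mx2_mulE (F : comNzRingType) (A B : 'M[F]_2) i j :
  (A *m B) i j = A i 0 * B 0 j + A i 1 * B 1 j.
Proof.
rewrite mxE !big_ord_recl big_ord0 addr0.
by congr (A _ _ * B _ _ + A _ _ * B _ _); apply/val_inj.
Qed.

Lemma glcM a b i j :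
  glc R (a * b)%g i j = glc R a i 0 * glc R b 0 j + glc R a i 1 * glc R b 1 j.
Proof.
rewrite /glc /= mx2_mulE !rmorphD /= !(rmorphM (@ratr R)).
by rewrite !(rmorphM (real_complex R)).
Qed.

(** Both this and [gldenomM] hold because [b] sends the column [(z, 1)] to [gldenom b z] times the
    column [(mobius b z, 1)]. *)
Lemma glnum_mobius a b z :
  glnum a (mobius b z) * gldenom b z = glnum (a * b)%g z.
Proof.
rewrite {1}/glnum mulrDl -mulrA divfK ?gldenom_neq0//.
by rewrite /glnum /gldenom !glcM; ring.
Qed.

Lemma gldenomM a b z :
  gldenom (a * b)%g z = gldenom a (mobius b z) * gldenom b z.
Proof.
rewrite {2}/gldenom mulrDl -mulrA divfK ?gldenom_neq0//.
by rewrite /glnum /gldenom !glcM; ring.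
Qed.

Lemma mobiusM a b z : mobius (a * b)%g z = mobius a (mobius b z).
Proof.
apply/val_inj; rewrite /= -glnum_mobius gldenomM.
by rewrite -mulf_div divff ?mulr1 // gldenom_neq0.
Qed.

Definition slash_factor k a : R[i] := ((ratr (\det a) : R) `^ (k%:R / 2))%:C.

Lemma ratr_det_gt0 a : 0 < ratr (\det a) :> R.
Proof. by rewrite ltr0q gl_det. Qed.

Lemma slash_factorM k a b :
  slash_factor k (a * b)%g = slash_factor k a * slash_factor k b.
Proof.
by rewrite /slash_factor /= det_mulmx rmorphM powRM ?rmorphM // ltW ?ratr_det_gt0.
Qed.

Lemma slash_factorD j k a :
  slash_factor (j + k) a = slash_factor j a * slash_factor k a.
Proof.
rewrite /slash_factor natrD mulrDl powRD ?(rmorphM (real_complex R)) //.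
by rewrite (gt_eqF (ratr_det_gt0 a)) implybT.
Qed.

Lemma slashE k f a z :
  slash k f a z = slash_factor k a * f (mobius a z) * gldenom a z ^- k.
Proof. by []. Qed.

Lemma slashM k f a b : slash k f (a * b)%g = slash k (slash k f a) b.
Proof.
apply/funext => z.
by rewrite !slashE slash_factorM mobiusM gldenomM exprMn invfM; ring.
Qed.

Lemma slash_mul j k f g a : slash (j + k) (f * g) a = slash j f a * slash k g a.
Proof.
apply/funext => z; rewrite !mulrfctE slashE slash_factorD exprD invfM.
by rewrite !slashE; ring.
Qed.

Lemma slashD k f g a : slash k (f + g) a = slash k f a + slash k g a.
Proof.
by apply/funext => z; rewrite !addrfctE !slashE mulrDr mulrDl.
Qed.

Lemma slash0 k a : slash k (0 : upper R -> R[i]) a = 0.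
Proof. by apply/funext => z; rewrite slashE mulr0 mul0r. Qed.

Lemma slash_cst0 c a : slash 0 (cst c : upper R -> R[i]) a = cst c.
Proof.
by apply/funext => z; rewrite slashE expr0 invr1 mulr1 /slash_factor mul0r powRr0 mul1r.
Qed.

Lemma mobius1 z : mobius 1%g z = z.
Proof.
apply/val_inj; rewrite /= /glnum /gldenom /glc !mxE /=.
by rewrite rmorph0 rmorph1 mul0r mul1r add0r addr0 divr1.
Qed.

Lemma slash1 k f : slash k f 1%g = f.
Proof.
apply/funext => z; rewrite slashE mobius1 /slash_factor det1 rmorph1 powR1 mul1r.
by rewrite /gldenom /glc !mxE /= rmorph0 rmorph1 mul0r add0r expr1n invr1 mulr1.
Qed.

End Slash.

(** * Holomorphy *)

Section Holomorphic.
Variable R : realType.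
Implicit Types (f g : upper R -> R[i]) (a b : GLpQ) (z : upper R) (k : nat).

Lemma near_upper z : \forall w \near (up_val z : R[i]^o), 0 < complex.Im w.
Proof.
(* The radius [Im z] works because [|Im z - Im w| <= |z - w|]. *)
exists (complex.Im z)%:C; first by rewrite /= ltcR up_gt0.
move=> w /=; rewrite normc_def ltcR => h.
rewrite -(subKr (complex.Im z) (complex.Im w)) subr_gt0.
apply: le_lt_trans h; apply: le_trans (ler_norm _) _.
rewrite -sqrtr_sqr ler_wsqrtr //.
by case: (up_val z) w => [x y] [u v] /=; rewrite lerDr sqr_ge0.
Qed.

Lemma holomorphic_cst (c : R[i]) : holomorphic (cst c : upper R -> R[i]).
Proof. by move=> z; exact: (derivable_cst (c : R[i]^o)). Qed.

Lemma holomorphicD f g : holomorphic f -> holomorphic g -> holomorphic (f + g).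
Proof. by move=> hf hg z; apply: derivableD (hf z) (hg z). Qed.

Lemma holomorphicM f g : holomorphic f -> holomorphic g -> holomorphic (f * g).
Proof. by move=> hf hg z; apply: derivableM (hf z) (hg z). Qed.

Lemma derivable_affine (p q w : R[i]) :
  derivable (fun x : R[i]^o => p * x + q : R[i]^o) w 1.
Proof.
apply: derivableD; last exact: derivable_cst.
by apply: (derivableM (f := cst (p : R[i]^o))); [exact: derivable_cst|exact: derivable_id].
Qed.

(** The chain and product rules apply to a formula on the plane that agrees with the extended slash
    near each point of the half-plane. *)
Lemma holomorphic_slash k f a : holomorphic f -> holomorphic (slash k f a).
Proof.
move=> hf z.
pose phi (w : R[i]^o) : R[i]^o := glnum a w / gldenom a w.
pose F (w : R[i]^o) : R[i]^o := f (insubd (point : upper R) w).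
have dV : derivable (fun w : R[i]^o => (gldenom a w)^-1 : R[i]^o) z 1.
  apply: derivableV; first exact: gldenom_neq0.
  exact: derivable_affine.
have dphi : derivable phi z 1 by apply: derivableM dV; exact: derivable_affine.
have dF : derivable (F \o phi) z 1.
  have dFz : derivable F (phi z) 1 := hf (mobius a z).
  have dphi' := (derivable1_diffP phi (z : R[i]^o)).1 dphi.
  have dFz' := (derivable1_diffP F (phi z)).1 dFz.
  exact: (derivable1_diffP _ _).2 (differentiable_comp dphi' dFz').
have := derivableM (derivableM (derivable_cst (slash_factor R k a : R[i]^o) _ _) dF)
  (derivableX (n := k) dV).
apply: near_eq_derivable; near=> w.
have w0 : 0 < complex.Im w by near: w; exact: near_upper.
have wE : up_val (insubd (point : upper R) w) = w by rewrite insubdK.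
rewrite slashE !mulrfctE exprfctE /= wE exprVn; congr (_ * f _ * _).
have := mobius_gt0 a (insubd (point : upper R) w); rewrite wE => h.
by apply/val_inj; rewrite insubdK //= wE.
Unshelve. all: by end_near.
Qed.

End Holomorphic.

(** * Growth as the imaginary part tends to infinity *)

Section Growth.
Variable R : realType.
Implicit Types (f g : upper R -> R[i]) (a b : GLpQ) (z : upper R) (k : nat).

(** The norm on [R[i]] is itself complex-valued; estimates need the underlying real number. *)
Lemma normc_realP (w : R[i]) : exists2 r : R, 0 <= r & `|w| = r%:C.
Proof. by rewrite normc_def; eexists; last reflexivity; exact: sqrtr_ge0. Qed.

Lemma bounded_at_ioo_cst (c : R[i]) : bounded_at_ioo (cst c : upper R -> R[i]).
Proof. by have [r _ rE] := normc_realP c; exists r, 0 => z _; rewrite rE. Qed.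

Lemma bounded_at_iooD f g :
  bounded_at_ioo f -> bounded_at_ioo g -> bounded_at_ioo (f + g).
Proof.
move=> [M [A fM]] [N [B gN]]; exists (M + N), (Num.max A B) => z.
rewrite ge_max => /andP[Az Bz]; rewrite addrfctE rmorphD.
by apply: le_trans (ler_normD _ _) _; rewrite lerD ?fM ?gN.
Qed.

Lemma bounded_at_iooM f g :
  bounded_at_ioo f -> bounded_at_ioo g -> bounded_at_ioo (f * g).
Proof.
move=> [M [A fM]] [N [B gN]]; exists (M * N), (Num.max A B) => z.
rewrite ge_max => /andP[Az Bz]; rewrite mulrfctE rmorphM normrM.
by rewrite ler_pM ?fM ?gN.
Qed.

Lemma vanishing_at_ioo0 : vanishing_at_ioo (0 : upper R -> R[i]).
Proof. by move=> e e0; exists 0 => z _; rewrite normr0 ler0c ltW. Qed.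

Lemma vanishing_at_iooD f g :
  vanishing_at_ioo f -> vanishing_at_ioo g -> vanishing_at_ioo (f + g).
Proof.
move=> f0 g0 e e0; have e20 : 0 < e / 2 by rewrite divr_gt0.
have [A fA] := f0 _ e20; have [B gB] := g0 _ e20.
exists (Num.max A B) => z; rewrite ge_max => /andP[Az Bz].
rewrite addrfctE [e]splitr rmorphD.
by apply: le_trans (ler_normD _ _) _; rewrite lerD ?fA ?gB.
Qed.

Lemma vanishing_at_iooM f g :
  bounded_at_ioo f -> vanishing_at_ioo g -> vanishing_at_ioo (f * g).
Proof.
(* [M] may be zero and its sign is not given, so [|M| + 1] serves as the divisor. *)
move=> [M [A fM]] g0 e e0; have N0 : 0 < `|M| + 1 by rewrite ltr_wpDl.
have [B gB] := g0 (e / (`|M| + 1)) (divr_gt0 e0 N0).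
exists (Num.max A B) => z; rewrite ge_max => /andP[Az Bz].
rewrite mulrfctE normrM.
apply: (@le_trans _ _ ((`|M| + 1)%:C * (e / (`|M| + 1))%:C)).
  rewrite ler_pM ?gB //; apply: le_trans (fM _ Az) _.
  by rewrite lecR ler_wpDr // ler_norm.
by rewrite -rmorphM lecR mulrCA divff ?mulr1 // gt_eqF.
Qed.

(** Such a matrix acts affinely, by [z -> (p * z + q) / s]; the ratio [p / s] is positive because
    [p * s] is the determinant. *)
Lemma mobius_triangular a : gl_mx a 1 0 = 0 ->
  exists2 t : R, 0 < t & forall z, complex.Im (mobius a z) = t * complex.Im z.
Proof.
move=> a10.
have ad0 : 0 < ratr (gl_mx a 0 0) * ratr (gl_mx a 1 1) :> R.
  have := ratr_det_gt0 R a.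
  by rewrite det_mx22 a10 mulr0 subr0 (rmorphM (@ratr R)).
have d0 : ratr (gl_mx a 1 1) != 0 :> R.
  by apply: contraTneq ad0 => ->; rewrite mulr0 ltxx.
exists (ratr (gl_mx a 0 0) / ratr (gl_mx a 1 1)).
  by rewrite -(pmulr_lgt0 _ (_ : 0 < ratr (gl_mx a 1 1) ^+ 2)) ?exprn_even_gt0 //
    expr2 mulrA divfK.
case=> -[x y] y0; rewrite /= /glnum /gldenom /glc a10 rmorph0 mul0r add0r.
by move: (ratr _) (ratr _) (ratr _) d0 => p q s s0 /=; field.
Qed.

Lemma slash_triangular k f a z : gl_mx a 1 0 = 0 ->
  slash k f a z = slash_factor R k a / glc R a 1 1 ^+ k * f (mobius a z).
Proof.
move=> a10; rewrite slashE mulrAC /gldenom.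
by rewrite {1}/glc a10 rmorph0 mul0r add0r.
Qed.

(** The factor in front of [f (mobius a z)] is constant, and heights are scaled by [t], so the
    threshold [B] becomes [B / t]. *)
Lemma bounded_at_ioo_triangular k f a : gl_mx a 1 0 = 0 ->
  bounded_at_ioo f -> bounded_at_ioo (slash k f a).
Proof.
move=> a10 [M [B fM]]; have [t t0 tE] := mobius_triangular a10.
have [r r0 rE] := normc_realP (slash_factor R k a / glc R a 1 1 ^+ k).
exists (r * M), (B / t) => z Bz; rewrite slash_triangular // normrM rE rmorphM.
by rewrite ler_wpM2l ?ler0c // fM // tE mulrC -ler_pdivrMr.
Qed.

Lemma vanishing_at_ioo_triangular k f a : gl_mx a 1 0 = 0 ->
  vanishing_at_ioo f -> vanishing_at_ioo (slash k f a).
Proof.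
move=> a10 f0 e e0; have [t t0 tE] := mobius_triangular a10.
have [r r0 rE] := normc_realP (slash_factor R k a / glc R a 1 1 ^+ k).
have r10 : 0 < r + 1 by rewrite ltr_wpDl.
have [B fB] := f0 (e / (r + 1)) (divr_gt0 e0 r10).
exists (B / t) => z Bz; rewrite slash_triangular // normrM rE.
apply: (@le_trans _ _ (r%:C * (e / (r + 1))%:C)).
  by rewrite ler_wpM2l ?ler0c // fB // tE mulrC -ler_pdivrMr.
by rewrite -rmorphM lecR mulrA ler_pdivrMr // mulrC ler_pM2l // lerDl.
Qed.

End Growth.

(** * Reduction to upper triangular matrices and change of level *)

(** The first column of [a] is proportional to a primitive integer vector; Bezout completes that
    vector to a matrix of SL2(Z), whose inverse sends the column to a multiple of the first basis
    vector. *)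
Lemma SL2Z_triangular (a : GLpQ) :
  exists g b : GLpQ, [/\ SL2Z g, a = (g * b)%g & gl_mx b 1 0 = 0].
Proof.
pose x := gl_mx a 0 0; pose y := gl_mx a 1 0.
pose X := numq x * denq y; pose Y := numq y * denq x.
have [D [xE yE]] : exists D : rat, x = X%:~R / D /\ y = Y%:~R / D.
  exists (denq x * denq y)%:~R; rewrite /X /Y !rmorphM /= !invfM; split.
    rewrite -{1}[x]divq_num_den mulrACA divff ?mulr1 //.
    by rewrite intr_eq0 denq_eq0.
  rewrite -{1}[y]divq_num_den [X in _ = _ * X]mulrC mulrACA.
  by rewrite divff ?mulr1 // intr_eq0 denq_eq0.
(* If [X] and [Y] both vanished, so would the first column of [a], against its positive
   determinant. *)
have h0 : gcdz X Y != 0.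
  rewrite gcdz_eq0; apply/negP => /andP[/eqP X0 /eqP Y0].
  have := gl_det a; rewrite det_mx22 -/x -/y xE yE X0 Y0.
  by rewrite !mul0r mulr0 subr0 ltxx.
have [u [v uvE]] := Bezoutz X Y.
pose X' := (X %/ gcdz X Y)%Z; pose Y' := (Y %/ gcdz X Y)%Z.
have XE : X = X' * gcdz X Y by rewrite divzK // dvdz_gcdl.
have YE : Y = Y' * gcdz X Y by rewrite divzK // dvdz_gcdr.
have uv1 : X' * u + v * Y' = 1.
  apply: (mulIf h0); rewrite mul1r -[RHS]uvE {2}XE {3}YE; ring.
pose m : 'M[int]_2 := \matrix_(i, j)
  if i == 0 then (if j == 0 then X' else - v) else (if j == 0 then Y' else u).
have m1 : \det (map_mx intr m : 'M[rat]_2) = 1.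
  by rewrite det_map_mx det_mx22 !mxE /= mulNr opprK uv1 rmorph1.
have m0 : 0 < \det (map_mx intr m : 'M[rat]_2) by rewrite m1.
pose g := MkGLpQ m0.
exists g, (g^-1 * a)%g; split; first by split=> //; exists m.
  by rewrite mulVKg.
(* This is the adjugate of [m], hence the integer form of [g^-1]. *)
pose m' : 'M[int]_2 := \matrix_(i, j)
  if i == 0 then (if j == 0 then u else v) else (if j == 0 then - Y' else X').
have mm' : m *m m' = 1%:M.
  apply/matrixP => i j; rewrite mx2_mulE !mxE /=.
  by case: i j => [[|[|//]] ?] [[|[|//]] ?]; rewrite /= ?mulr1n; move: uv1; lia.
have gV : gl_mx (g^-1)%g = map_mx intr m'.
  by rewrite -[RHS](mulKmx (GLpQ_unit g)) /= -map_mxM mm' map_mx1 mulmx1.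
(* The proportionality of [(X, Y)] and [(X', Y')] makes the lower left entry of [g^-1 * a]
   vanish. *)
have XY : Y' * X = X' * Y by rewrite [in LHS]XE [in RHS]YE mulrCA mulrA.
rewrite [LHS]mx2_mulE gV !mxE /= -/x -/y xE yE.
by rewrite rmorphN mulNr !mulrA -!rmorphM XY addNr.
Qed.

Lemma common_denominator (A : 'M[rat]_2) :
  exists2 d : nat, (0 < d)%N & exists m : 'M[int]_2, d%:R *: A = map_mx intr m.
Proof.
pose d := \prod_(p : 'I_2 * 'I_2) `|denq (A p.1 p.2)|%N.
exists d; first by rewrite prodn_gt0 // => p; rewrite absz_gt0 denq_eq0.
exists (\matrix_(i, j) (numq (A i j) *
  (\prod_(p : 'I_2 * 'I_2 | p != (i, j)) `|denq (A p.1 p.2)|)%N%:Z)).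
apply/matrixP => i j; rewrite !mxE /d (bigD1 (i, j)) //= natrM mulrAC.
rewrite rmorphM /= numqE mulrC [RHS]mulrC -pmulrn; congr (_ * _).
by rewrite mulrC natr_absz ger0_norm // denq_ge0.
Qed.

(** If [d a] and [d' a^-1] are integral and [g = 1 + N d d' n], then
    [a g a^-1 = 1 + N (d a) n (d' a^-1)]. *)
Lemma conj_GammaN (a : GLpQ) (N : nat) : (0 < N)%N ->
  exists2 N', (0 < N')%N & forall g, GammaN N' g -> GammaN N (a * g * a^-1)%g.
Proof.
move=> N0; have [d d0 [m mE]] := common_denominator (gl_mx a).
have [d' d'0 [m' m'E]] := common_denominator (gl_mx (a^-1)%g).
exists (N * (d * d'))%N; first by rewrite !muln_gt0 N0 d0.
move=> g [g1 [n nE]]; split.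
  rewrite /= !det_mulmx g1 mulr1 det_inv mulfV //.
  by rewrite gt_eqF // gl_det.
exists (m *m n *m m'); rewrite /= nE !map_mxM /= -mE -m'E.
rewrite mulmxDr mulmx1 mulmxDl mulmxV ?GLpQ_unit //; congr (_ + _).
rewrite -!(scalemxAl, scalemxAr) !scalerA !natrM; congr (_ *: _).
by ring.
Qed.

Lemma GammaN_mul (N N' : nat) : GammaN (N * N') `<=` GammaN N.
Proof.
move=> g [g1 [m mE]]; split=> //; exists (N'%:R *: m).
by rewrite mE natrM -scalerA map_mxZ rmorph_nat.
Qed.

(** * Stability of modular and cusp forms *)

Section ModularForms.
Variable R : realType.
Implicit Types (f h : upper R -> R[i]) (a b g : GLpQ) (k : nat).

(** Reduces a growth condition on all of GL2+(Q) to SL2(Z) and triangular matrices, through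
    [SL2Z_triangular]. *)
Lemma slash_stable (P : (upper R -> R[i]) -> Prop) k f a :
  (forall h b, gl_mx b 1 0 = 0 -> P h -> P (slash k h b)) ->
  (forall g, SL2Z g -> P (slash k f g)) -> P (slash k f a).
Proof.
move=> Pb Pg; have [g [b [gS -> b10]]] := SL2Z_triangular a.
by rewrite slashM; apply: Pb => //; exact: Pg.
Qed.

Lemma modular_form_bounded (G : set GLpQ) k f a :
  modular_form G k f -> bounded_at_ioo (slash k f a).
Proof.
move=> [_ _ fb]; apply: slash_stable fb => h b.
exact: bounded_at_ioo_triangular.
Qed.

Lemma cusp_form_vanishing (G : set GLpQ) k f a :
  cusp_form G k f -> vanishing_at_ioo (slash k f a).
Proof.
move=> [_ fb]; apply: slash_stable fb => h b.
exact: vanishing_at_ioo_triangular.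
Qed.

(** Only the invariance clause of [modular_form] mentions the group; the growth clause ranges over
    SL2(Z) at every level. *)
Lemma modular_formS (G H : set GLpQ) k f :
  modular_form G k f -> (forall g, H g -> slash k f g = f) -> modular_form H k f.
Proof. by case. Qed.

(** Invariance follows from [(f|a)|g = (f|(a g a^-1))|a]; growth is [modular_form_bounded] at
    [a * g], which need not lie in SL2(Z). *)
Lemma modular_form_slash (G H : set GLpQ) k f a :
  (forall g, H g -> G (a * g * a^-1)%g) ->
  modular_form G k f -> modular_form H k (slash k f a).
Proof.
move=> HG fG; split.
- exact: holomorphic_slash (modular_holomorphic fG).
- move=> g /HG /(modular_invariant fG) gf.
  by rewrite -slashM -{2}gf -slashM mulgVK.
- by move=> g _; rewrite -slashM; exact: modular_form_bounded fG.
Qed.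

Lemma cusp_form_slash (G H : set GLpQ) k f a :
  (forall g, H g -> G (a * g * a^-1)%g) ->
  cusp_form G k f -> cusp_form H k (slash k f a).
Proof.
move=> HG fG; split; first exact: modular_form_slash HG fG.1.
by move=> g _; rewrite -slashM; exact: cusp_form_vanishing fG.
Qed.

Lemma modular_form0 (G : set GLpQ) k : modular_form G k (0 : upper R -> R[i]).
Proof.
split; first exact: (@holomorphic_cst R 0).
  by move=> g _; rewrite slash0.
by move=> g _; rewrite slash0; exact: (@bounded_at_ioo_cst R 0).
Qed.

Lemma modular_formD (G : set GLpQ) k f h :
  modular_form G k f -> modular_form G k h -> modular_form G k (f + h).
Proof.
move=> [fh fi fb] [gh gi gb]; split; first exact: holomorphicD.
  by move=> a Ga; rewrite slashD fi ?gi.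
by move=> a aS; rewrite slashD; apply: bounded_at_iooD; [exact: fb|exact: gb].
Qed.

Lemma modular_formM (G : set GLpQ) j k f h :
  modular_form G j f -> modular_form G k h -> modular_form G (j + k) (f * h).
Proof.
move=> [fh fi fb] [gh gi gb]; split; first exact: holomorphicM.
  by move=> a Ga; rewrite slash_mul fi ?gi.
by move=> a aS; rewrite slash_mul; apply: bounded_at_iooM; [exact: fb|exact: gb].
Qed.

Lemma modular_form_cst (G : set GLpQ) (c : R[i]) :
  modular_form G 0 (cst c : upper R -> R[i]).
Proof.
split; first exact: holomorphic_cst.
  by move=> a _; rewrite slash_cst0.
by move=> a _; rewrite slash_cst0; exact: bounded_at_ioo_cst.
Qed.

Lemma cusp_form0 (G : set GLpQ) k : cusp_form G k (0 : upper R -> R[i]).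
Proof.
split; first exact: modular_form0.
by move=> g _; rewrite slash0; exact: vanishing_at_ioo0.
Qed.

Lemma cusp_formD (G : set GLpQ) k f h :
  cusp_form G k f -> cusp_form G k h -> cusp_form G k (f + h).
Proof.
move=> [fM f0] [gM g0]; split; first exact: modular_formD.
by move=> a aS; rewrite slashD; apply: vanishing_at_iooD; [exact: f0|exact: g0].
Qed.

Lemma cusp_formM (G : set GLpQ) j k f h :
  modular_form G j f -> cusp_form G k h -> cusp_form G (j + k) (f * h).
Proof.
move=> fM [gM g0]; split; first exact: modular_formM.
move=> a aS; rewrite slash_mul; apply: vanishing_at_iooM; last exact: g0.
exact: modular_bounded fM _ aS.
Qed.

End ModularForms.

(** * The graded algebra of modular forms *)

Section GradedForms.
Variable R : realType.
Implicit Types (f g : gform R) (a b : GLpQ).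

(** Truncating at [size f] loses nothing, as slashing zero gives zero. *)
Lemma coef_gslash f a k : (gslash f a)`_k = slash k f`_k a.
Proof.
rewrite coef_poly; case: ltnP => // le_f_k.
by rewrite nth_default // slash0.
Qed.

Lemma gslash0 a : gslash (0 : gform R) a = 0.
Proof. by apply/polyP => k; rewrite coef_gslash !coef0 slash0. Qed.

Lemma gslashD f g a : gslash (f + g) a = gslash f a + gslash g a.
Proof. by apply/polyP => k; rewrite coefD !coef_gslash coefD slashD. Qed.

Lemma gslash_sum (I : Type) (r : seq I) (F : I -> gform R) a :
  gslash (\sum_(i <- r) F i) a = \sum_(i <- r) gslash (F i) a.
Proof. exact: (big_morph (@gslash R ^~ a) (fun f g => gslashD f g a) (gslash0 a)). Qed.

(** The coefficient of weight [k] collects products of weights [i] and [k - i], to each of which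
    [slash_mul] applies. *)
Lemma gslashM f g a : gslash (f * g) a = gslash f a * gslash g a.
Proof.
apply/polyP => k; rewrite coef_gslash !coefM.
rewrite (big_morph (fun h => slash k h a) (fun h h' => slashD k h h' a) (slash0 R k a)).
apply: eq_bigr => i _; rewrite !coef_gslash -slash_mul subnKC //.
by rewrite -ltnS.
Qed.

Lemma gslash_mulg f a b : gslash f (a * b)%g = gslash (gslash f a) b.
Proof. by apply/polyP => k; rewrite !coef_gslash slashM. Qed.

Lemma gslash_1g f : gslash f 1%g = f.
Proof. by apply/polyP => k; rewrite !coef_gslash slash1. Qed.

Definition gcst (c : R[i]) : gform R := (cst c : upper R -> R[i])%:P.

Lemma gslash_cst c a : gslash (gcst c) a = gcst c.
Proof.
apply/polyP => k; rewrite coef_gslash /gcst coefC.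
by case: k => [|k] /=; rewrite ?slash_cst0 ?slash0.
Qed.

(** Scaling becomes multiplication by a form of weight zero, so linearity and closure under scalars
    reduce to statements about products. *)
Lemma gform_scaleE (c : R[i]) f : c *: f = gcst c * f.
Proof. by rewrite mul_polyC. Qed.

Lemma gslash_one a : gslash (1 : gform R) a = 1.
Proof. exact: (gslash_cst 1). Qed.

Lemma Mod_cst (G : set GLpQ) c : Mod R G (gcst c).
Proof.
move=> k; rewrite /gcst coefC; case: k => [|k] /=.
  exact: modular_form_cst.
exact: modular_form0.
Qed.

Lemma Mod0_0 (G : set GLpQ) : Mod0 R G 0.
Proof. by move=> k; rewrite coef0; exact: cusp_form0. Qed.

Lemma ModD (G : set GLpQ) f g : Mod R G f -> Mod R G g -> Mod R G (f + g).
Proof. by move=> fG gG k; rewrite coefD; exact: modular_formD. Qed.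

Lemma Mod0D (G : set GLpQ) f g : Mod0 R G f -> Mod0 R G g -> Mod0 R G (f + g).
Proof. by move=> fG gG k; rewrite coefD; exact: cusp_formD. Qed.

Lemma ModM (G : set GLpQ) f g : Mod R G f -> Mod R G g -> Mod R G (f * g).
Proof.
move=> fG gG k; rewrite coefM; elim/big_ind: _ => [|h h'|i _].
- exact: modular_form0.
- exact: modular_formD.
by have := modular_formM (fG i) (gG (k - i)%N); rewrite subnKC // -ltnS.
Qed.

Lemma Mod0M (G : set GLpQ) f g : Mod R G f -> Mod0 R G g -> Mod0 R G (f * g).
Proof.
move=> fG gG k; rewrite coefM; elim/big_ind: _ => [|h h'|i _].
- exact: cusp_form0.
- exact: cusp_formD.
by have := cusp_formM (fG i) (gG (k - i)%N); rewrite subnKC // -ltnS.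
Qed.

Lemma Mod0_sub (G : set GLpQ) f : Mod0 R G f -> Mod R G f.
Proof. by move=> fG k; case: (fG k). Qed.

Lemma Mod_slash (G H : set GLpQ) f a :
  (forall g : GLpQ, H g -> G (a * g * a^-1)%g) -> Mod R G f -> Mod R H (gslash f a).
Proof. by move=> HG fG k; rewrite coef_gslash; apply: modular_form_slash (fG k). Qed.

Lemma Mod0_slash (G H : set GLpQ) f a :
  (forall g : GLpQ, H g -> G (a * g * a^-1)%g) -> Mod0 R G f -> Mod0 R H (gslash f a).
Proof. by move=> HG fG k; rewrite coef_gslash; apply: cusp_form_slash (fG k). Qed.

(** Used to bring forms from an auxiliary level [Gamma(N)] down to the congruence subgroup
    itself. *)
Lemma Mod_invariant (G H : set GLpQ) f :
  Mod R G f -> (forall g : GLpQ, H g -> gslash f g = f) -> Mod R H f.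
Proof.
by move=> fG fH k; apply: modular_formS (fG k) _ => g /fH {2}<-; rewrite coef_gslash.
Qed.

Lemma Mod0_invariant (G H : set GLpQ) f :
  Mod0 R G f -> (forall g : GLpQ, H g -> gslash f g = f) -> Mod0 R H f.
Proof.
move=> fG fH k; split; last by case: (fG k).
exact: Mod_invariant (Mod0_sub fG) fH k.
Qed.

Lemma gslash_invariant (G : set GLpQ) f (g : GLpQ) : Mod R G f -> G g -> gslash f g = f.
Proof.
by move=> fG Gg; apply/polyP => k; rewrite coef_gslash (modular_invariant (fG k)).
Qed.

Lemma ModS (G H : set GLpQ) : H `<=` G -> Mod R G `<=` Mod R H.
Proof.
move=> HG f fG; apply: Mod_invariant (fG) _ => g /HG.
exact: gslash_invariant.
Qed.

Lemma Mod0S (G H : set GLpQ) : H `<=` G -> Mod0 R G `<=` Mod0 R H.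
Proof.
move=> HG f fG; apply: Mod0_invariant (fG) _ => g /HG.
exact: gslash_invariant (Mod0_sub fG).
Qed.

Lemma GammaN_mulr (N N' : nat) : GammaN (N' * N) `<=` GammaN N.
Proof. by rewrite mulnC; exact: GammaN_mul. Qed.

Lemma Mod_all_cst c : Mod_all (gcst c).
Proof. by exists 1%N => //; exact: Mod_cst. Qed.

(** Levels [N] and [M] are both refined by the level [N * M]. *)
Lemma Mod_allD f g : Mod_all f -> Mod_all g -> Mod_all (f + g).
Proof.
move=> [N N0 fN] [M M0 gM]; exists (N * M)%N; first by rewrite /= muln_gt0 N0.
by apply: ModD; [exact: (ModS (@GammaN_mul N M) fN)|exact: (ModS (@GammaN_mulr M N) gM)].
Qed.

Lemma Mod_allM f g : Mod_all f -> Mod_all g -> Mod_all (f * g).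
Proof.
move=> [N N0 fN] [M M0 gM]; exists (N * M)%N; first by rewrite /= muln_gt0 N0.
by apply: ModM; [exact: (ModS (@GammaN_mul N M) fN)|exact: (ModS (@GammaN_mulr M N) gM)].
Qed.

Lemma Mod0_all0 : Mod0_all (0 : gform R).
Proof. by exists 1%N => //; exact: Mod0_0. Qed.

Lemma Mod0_allD f g : Mod0_all f -> Mod0_all g -> Mod0_all (f + g).
Proof.
move=> [N N0 fN] [M M0 gM]; exists (N * M)%N; first by rewrite /= muln_gt0 N0.
by apply: Mod0D; [exact: (Mod0S (@GammaN_mul N M) fN)|exact: (Mod0S (@GammaN_mulr M N) gM)].
Qed.

Lemma Mod0_allM f g : Mod_all f -> Mod0_all g -> Mod0_all (f * g).
Proof.
move=> [N N0 fN] [M M0 gM]; exists (N * M)%N; first by rewrite /= muln_gt0 N0.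
by apply: Mod0M; [exact: (ModS (@GammaN_mul N M) fN)|exact: (Mod0S (@GammaN_mulr M N) gM)].
Qed.

Lemma Mod_all_slash f a : Mod_all f -> Mod_all (gslash f a).
Proof.
move=> [N N0 fN]; have [N' N'0 NN'] := conj_GammaN a N0.
by exists N' => //; exact: Mod_slash fN.
Qed.

Lemma Mod0_all_slash f a : Mod0_all f -> Mod0_all (gslash f a).
Proof.
move=> [N N0 fN]; have [N' N'0 NN'] := conj_GammaN a N0.
by exists N' => //; exact: Mod0_slash fN.
Qed.

Lemma Mod0_all_sub f : Mod0_all f -> Mod_all f.
Proof. by move=> [N N0 /Mod0_sub fN]; exists N. Qed.

End GradedForms.

(** * Sums over cosets *)

Section CosetSums.
Variable G : set GLpQ.
Hypothesis G1 : G 1%g.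
Hypothesis GM : forall a b, G a -> G b -> G (a * b)%g.
Hypothesis GV : forall a, G a -> G (a^-1)%g.
Implicit Types (a b c g : GLpQ) (C : set GLpQ).

Local Notation rep := (xget 1%g).

Lemma gcosetMl g a : G g -> gcoset G (g * a)%g = gcoset G a.
Proof.
move=> Gg; apply/seteqP; split=> _ [h Gh <-].
  by exists (h * g)%g; rewrite ?mulgA //; exact: GM.
exists (h * g^-1)%g; last by rewrite -mulgA mulKg.
by apply: GM => //; exact: GV.
Qed.

Lemma gcoset_id a : gcoset G a a.
Proof. by exists 1%g => //; rewrite mul1g. Qed.

Lemma rep_gcoset a : exists2 g, G g & rep (gcoset G a) = (g * a)%g.
Proof. by have [g Gg <-] := xgetI 1%g (gcoset_id a); exists g. Qed.

Lemma gcoset_rep C : range (gcoset G) C -> gcoset G (rep C) = C.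
Proof. by move=> [a _ <-]; have [g Gg ->] := rep_gcoset a; exact: gcosetMl. Qed.

Lemma gcoset_eq a b : gcoset G a = gcoset G b -> exists2 g, G g & a = (g * b)%g.
Proof. by move=> ab; have := gcoset_id a; rewrite ab => -[g Gg <-]; exists g. Qed.

Definition rcosetM c C : set GLpQ := [set (x * c)%g | x in C].

Lemma gcosetMr a c : gcoset G (a * c)%g = rcosetM c (gcoset G a).
Proof.
apply/seteqP; split=> [_ [h Gh <-]|_ [_ [h Gh <-] <-]].
  by exists (h * a)%g; rewrite ?mulgA //; exists h.
by exists h; rewrite ?mulgA.
Qed.

(** Right translation commutes with the left action of [G], and translation by [c^-1] inverts it. *)
Lemma rcosetM_bij c : set_bij (range (gcoset G)) (range (gcoset G)) (rcosetM c).
Proof.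
split=> [_ [a _ <-]|C D|_ [a _ <-]].
- by exists (a * c)%g; rewrite ?gcosetMr.
- rewrite !inE => -[a _ <-] [b _ <-]; rewrite -!gcosetMr => /gcoset_eq[g Gg].
  by rewrite mulgA => /mulIg ->; exact: gcosetMl.
by exists (gcoset G (a * c^-1)%g) => //; rewrite -gcosetMr mulgVK.
Qed.

Variable V : nmodType.
Implicit Types t u : GLpQ -> V.

Definition left_invariant t := forall g a, G g -> t (g * a)%g = t a.

Definition coset_support t : set (set GLpQ) := gcoset G @` [set a | t a != 0].

(** Right translation by [c] permutes the cosets; the translated representative and the chosen one
    differ by an element of [G], which [t] ignores. *)
Lemma coset_sum_reindex t c : left_invariant t ->
  coset_sum G t = coset_sum G (fun a => t (a * c)%g).
Proof.
move=> tG; rewrite /coset_sum (reindex_fsbig _ _ _ _ (rcosetM_bij c)).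
apply: eq_fsbigr => C; rewrite inE => -[a _ <-]; rewrite -gcosetMr.
have [g Gg ->] := rep_gcoset (a * c)%g; have [h Gh ->] := rep_gcoset a.
by rewrite tG // -mulgA [RHS]tG.
Qed.

(** Puts the sums of several families over one common finite index set, where they can be compared
    term by term. *)
Lemma coset_sum_finite t (A : set (set GLpQ)) : finite_set A ->
  A `<=` range (gcoset G) -> coset_support t `<=` A ->
  coset_sum G t = \sum_(C <- fset_set A) t (rep C).
Proof.
move=> finA AG tA; rewrite -fsbig_finite //.
apply/esym/fsbig_widen => // C [CG nAC] /=; apply: contrapT => /eqP tC; apply: nAC.
by rewrite -(gcoset_rep CG); apply: tA; exists (rep C).
Qed.

Lemma coset_support_range t : coset_support t `<=` range (gcoset G).
Proof. by move=> _ [a _ <-]; exists a. Qed.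

Lemma coset_sum_neq0 t : coset_sum G t != 0 ->
  exists2 C, range (gcoset G) C & t (rep C) != 0.
Proof. exact: (@fsbigN1 _ _ _ unit _ _ (fun=> fun C => t (rep C)) tt). Qed.

Lemma coset_sum_single t c : left_invariant t ->
  (forall a, t a != 0 -> gcoset G a = gcoset G c) -> coset_sum G t = t c.
Proof.
move=> tG tc; rewrite (@coset_sum_finite _ [set gcoset G c]) //.
- by rewrite fset_set1 big_seq_fset1; have [g Gg ->] := rep_gcoset c; exact: tG.
- by move=> _ ->; exists c.
by move=> _ [a /tc ? <-].
Qed.

(* No finiteness is needed: [\sum_(C \in _)] is 0 on an infinite support. *)
Lemma coset_sum_ind (P : V -> Prop) t : P 0 ->
  (forall x y, P x -> P y -> P (x + y)) -> (forall a, P (t a)) ->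
  P (coset_sum G t).
Proof. by move=> P0 PD Pt; apply: big_ind. Qed.

End CosetSums.

(** * Hecke operator forms *)

Section HeckeAlgebra.
Variables (R : realType) (G : set GLpQ).
Hypothesis G1 : G 1%g.
Hypothesis GM : forall a b, G a -> G b -> G (a * b)%g.
Hypothesis GV : forall a, G a -> G (a^-1)%g.
Implicit Types (F : GLpQ -> gform R) (f : gform R) (a b c g : GLpQ).

Local Notation rep := (xget 1%g).

Definition right_covariant F := forall g a, G g -> F (a * g)%g = gslash (F a) g.

(** Replacing [b] by [g b] turns [F2 (a b^-1)] into [F2 (a b^-1) | g^-1], and slashing by [g b] then
    undoes the [g^-1]. *)
Lemma hecke_mul_term_left_invariant F1 F2 a :
  left_invariant G F1 -> right_covariant F2 ->
  left_invariant G (hecke_mul_term F1 F2 a).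
Proof.
move=> F1G F2G g b Gg; rewrite /hecke_mul_term F1G // invgM mulgA.
by rewrite (F2G (g^-1)%g (a * b^-1)%g (GV Gg)) -gslash_mulg mulKg.
Qed.

Lemma hecke_mul_term_neq0 F1 F2 a b :
  hecke_mul_term F1 F2 a b != 0 -> F1 b != 0 /\ F2 (a * b^-1)%g != 0.
Proof.
rewrite /hecke_mul_term => t0; split; apply: contraNneq t0 => ->.
  by rewrite mul0r.
by rewrite gslash0 mulr0.
Qed.

(** The bound does not depend on [a], so the support of [F1] indexes the product at every [a]. *)
Lemma hecke_mul_term_support F1 F2 a :
  coset_support G (hecke_mul_term F1 F2 a) `<=` coset_support G F1.
Proof. by move=> _ [b /hecke_mul_term_neq0[F1b _] <-]; exists b. Qed.

Lemma hecke_mul_finite F1 F2 a (A : set (set GLpQ)) : finite_set A ->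
  A `<=` range (gcoset G) -> coset_support G F1 `<=` A ->
  hecke_mul G F1 F2 a = \sum_(C <- fset_set A) hecke_mul_term F1 F2 a (rep C).
Proof.
move=> finA AG F1A; apply: coset_sum_finite => //.
exact: subset_trans (@hecke_mul_term_support _ _ _) F1A.
Qed.

Lemma hecke_linE (k : R[i]) F1 F2 a : (k *: F1 + F2) a = gcst k * F1 a + F2 a.
Proof. by rewrite -gform_scaleE. Qed.

Lemma coset_support_linear (k : R[i]) F1 F2 :
  coset_support G (k *: F1 + F2) `<=` coset_support G F1 `|` coset_support G F2.
Proof.
move=> _ [a /eqP Fa <-]; have [F1a|F1a] := eqVneq (F1 a) 0; last by left; exists a.
right; exists a => //; apply/eqP => F2a.
by apply: Fa; rewrite hecke_linE F1a F2a mulr0 add0r.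
Qed.

Lemma hecke_mul_linearl (k : R[i]) F1 F2 F3 :
  finite_set (coset_support G F1) -> finite_set (coset_support G F2) ->
  hecke_mul G (k *: F1 + F2) F3 = k *: hecke_mul G F1 F3 + hecke_mul G F2 F3.
Proof.
move=> fin1 fin2; apply/funext => a.
(* All three products are expanded over the union of the two supports. *)
have finA : finite_set (coset_support G F1 `|` coset_support G F2) by rewrite finite_setU.
have AG : coset_support G F1 `|` coset_support G F2 `<=` range (gcoset G).
  by rewrite subUset; split; exact: coset_support_range.
rewrite hecke_linE.
rewrite !(hecke_mul_finite _ _ finA AG);
  [|exact: subsetUr|exact: subsetUl|exact: coset_support_linear].
rewrite mulr_sumr -big_split /=; apply: eq_bigr => C _.
by rewrite /hecke_mul_term hecke_linE mulrDl mulrA.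
Qed.

Lemma hecke_mul_linearr (k : R[i]) F1 F2 F3 :
  finite_set (coset_support G F3) ->
  hecke_mul G F3 (k *: F1 + F2) = k *: hecke_mul G F3 F1 + hecke_mul G F3 F2.
Proof.
move=> fin3; apply/funext => a.
rewrite hecke_linE.
rewrite !(hecke_mul_finite _ _ fin3 (@coset_support_range _ _ _)) //.
rewrite mulr_sumr -big_split /=; apply: eq_bigr => C _.
by rewrite /hecke_mul_term hecke_linE gslashD gslashM gslash_cst mulrDr mulrCA.
Qed.

Lemma hecke_mul_left_invariant F1 F2 :
  left_invariant G F2 -> left_invariant G (hecke_mul G F1 F2).
Proof.
move=> F2G g a Gg; rewrite /hecke_mul; congr coset_sum; apply/funext => b.
by rewrite /hecke_mul_term -mulgA (F2G g _ Gg).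
Qed.

(** After the substitution [b -> b g] each term is slashed by [g] as a whole: [F1 (b g) = F1 b | g],
    while [a g (b g)^-1 = a b^-1]. *)
Lemma hecke_mul_right_covariant F1 F2 :
  finite_set (coset_support G F1) -> left_invariant G F1 ->
  right_covariant F1 -> right_covariant F2 ->
  right_covariant (hecke_mul G F1 F2).
Proof.
move=> fin1 F1l F1r F2r g a Gg.
rewrite {1}/hecke_mul (coset_sum_reindex G1 GM GV g); last first.
  exact: hecke_mul_term_left_invariant.
rewrite (@coset_sum_finite _ G1 GM GV _ _ _ fin1 (@coset_support_range _ _ _)); last first.
  (* Slashing zero gives zero, so the translated family is still supported in the support of
     [F1]. *)
  move=> _ [b /hecke_mul_term_neq0[+ _] <-]; rewrite F1r // => F1b; exists b => //=.
  by apply: contraNneq F1b => ->; rewrite gslash0.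
rewrite (hecke_mul_finite _ _ fin1 (@coset_support_range _ _ _)) // gslash_sum.
apply: eq_bigr => C _; rewrite /hecke_mul_term gslashM -gslash_mulg F1r //.
by rewrite invgM mulgA mulgK.
Qed.

(** The cosets of [x b], with [G x] in the support of [F2] and [b] the chosen representative of a
    coset in the support of [F1]. They carry the product since [a = (a b^-1) b]. *)
Definition product_support F1 F2 : set (set GLpQ) :=
  [set rcosetM (rep p.1) p.2 | p in coset_support G F1 `*` coset_support G F2].

Lemma product_support_finite F1 F2 :
  finite_set (coset_support G F1) -> finite_set (coset_support G F2) ->
  finite_set (product_support F1 F2).
Proof. by move=> fin1 fin2; apply/finite_image/finite_setX. Qed.

Lemma product_support_range F1 F2 : product_support F1 F2 `<=` range (gcoset G).
Proof.
move=> _ [[C _] [_ [a _ <-]] <-] /=.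
by exists (a * rep C)%g => //; rewrite gcosetMr.
Qed.

Lemma product_supportP F1 F2 C a : coset_support G F1 C ->
  F2 (a * (rep C)^-1)%g != 0 -> product_support F1 F2 (gcoset G a).
Proof.
move=> F1C F2a; exists (C, gcoset G (a * (rep C)^-1)%g).
  by split=> //; exists (a * (rep C)^-1)%g.
by rewrite -gcosetMr mulgVK.
Qed.

Lemma hecke_mul_support F1 F2 :
  coset_support G (hecke_mul G F1 F2) `<=` product_support F1 F2.
Proof.
move=> _ [a + <-] => /coset_sum_neq0[C CG /hecke_mul_term_neq0[F1C F2a]].
apply: product_supportP F2a; exists (rep C) => //.
exact: gcoset_rep.
Qed.

(** Both sides become the same double sum, over [b] in the support of [F1] and [e] in the product
    support, of the product of [F1 b], [F2 (e b^-1) | b] and [F3 (a e^-1) | e]. *)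
Lemma hecke_mulA F1 F2 F3 :
  finite_set (coset_support G F1) -> finite_set (coset_support G F2) ->
  left_invariant G F2 -> right_covariant F3 ->
  hecke_mul G F1 (hecke_mul G F2 F3) = hecke_mul G (hecke_mul G F1 F2) F3.
Proof.
move=> fin1 fin2 F2G F3G; apply/funext => a.
pose A := coset_support G F1; pose B := product_support F1 F2.
have AG : A `<=` range (gcoset G) by exact: coset_support_range.
have finB : finite_set B by exact: product_support_finite.
have BG : B `<=` range (gcoset G) by exact: product_support_range.
pose T (C E : set GLpQ) := let b := rep C in let e := rep E in
  F1 b * gslash (F2 (e * b^-1)%g) b * gslash (F3 (a * e^-1)%g) e.
transitivity (\sum_(C <- fset_set A) \sum_(E <- fset_set B) T C E).
  rewrite (hecke_mul_finite _ _ fin1 AG) //.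
  (* [big_seq] records that [C] lies in the support of [F1], which confines the inner sum to [B]. *)
  rewrite big_seq [RHS]big_seq; apply: eq_bigr => C.
  rewrite in_fset_set // inE => AC; rewrite /hecke_mul_term.
  (* Shifting the inner variable by the inverse of [b = rep C] makes it the [e] of the other
     side. *)
  rewrite {1}/hecke_mul (coset_sum_reindex G1 GM GV (rep C)^-1%g); last first.
    exact: hecke_mul_term_left_invariant.
  rewrite (@coset_sum_finite _ G1 GM GV _ _ _ finB BG); last first.
    move=> _ [e /hecke_mul_term_neq0[F2e _] <-].
    exact: product_supportP F2e.
  rewrite gslash_sum mulr_sumr; apply: eq_bigr => E _.
  rewrite /hecke_mul_term /T gslashM -gslash_mulg mulgVK mulrA.
  by rewrite invgM invgK mulgA mulgVK.
rewrite exchange_big (hecke_mul_finite _ _ finB BG); last exact: hecke_mul_support.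
apply: eq_bigr => E _; rewrite {1}/hecke_mul_term.
by rewrite (hecke_mul_finite _ _ fin1 AG) // mulr_suml.
Qed.

Definition hecke_one : GLpQ -> gform R := fun a => if `[< G a >] then 1 else 0.

Lemma hecke_one_neq0 a : hecke_one a != 0 -> G a.
Proof. by rewrite /hecke_one; case: asboolP => //; rewrite eqxx. Qed.

Lemma hecke_one_left_invariant : left_invariant G hecke_one.
Proof.
move=> g a Gg; rewrite /hecke_one; congr (if _ then _ else _).
apply: asbool_equiv_eq; split=> [Gga|]; last exact: GM.
by rewrite -(mulKg g a); apply: GM => //; exact: GV.
Qed.

Lemma hecke_one_right_covariant : right_covariant hecke_one.
Proof.
move=> g a Gg; rewrite /hecke_one.
rewrite (_ : `[< G (a * g)%g >] = `[< G a >]).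
  by case: asboolP => _; [rewrite gslash_one|rewrite gslash0].
apply: asbool_equiv_eq; split=> [Gga|Ga]; last exact: GM.
by rewrite -(mulgK g a); apply: GM => //; exact: GV.
Qed.

(** Only the trivial coset contributes. *)
Lemma hecke_mul1 F : right_covariant F -> hecke_mul G hecke_one F = F.
Proof.
move=> FG; apply/funext => a; rewrite /hecke_mul (coset_sum_single G1 GM GV (c := 1%g)).
- rewrite /hecke_mul_term /hecke_one; case: asboolP => // _.
  by rewrite mul1r invg1 mulg1 gslash_1g.
- exact: hecke_mul_term_left_invariant hecke_one_left_invariant FG.
move=> b /hecke_mul_term_neq0[/hecke_one_neq0 Gb _].
by rewrite -[b]mulg1; exact: gcosetMl.
Qed.

(** The second factor survives only for [a b^-1] in [G], that is, on the coset of [a]. *)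
Lemma hecke_mulr1 F : left_invariant G F -> hecke_mul G F hecke_one = F.
Proof.
move=> FG; apply/funext => a; rewrite /hecke_mul (coset_sum_single G1 GM GV (c := a)).
- rewrite /hecke_mul_term mulgV /hecke_one; case: asboolP => // _.
  by rewrite gslash_one mulr1.
- exact: hecke_mul_term_left_invariant FG hecke_one_right_covariant.
move=> b /hecke_mul_term_neq0[_ /hecke_one_neq0 Gab].
by rewrite -[a in RHS](mulgVK b); exact/esym/gcosetMl.
Qed.

End HeckeAlgebra.

(** * Hecke operator forms for a congruence subgroup *)

Section HeckeForms.
Variables (R : realType) (G : set GLpQ).
Hypothesis hG : congruence_subgroup G.
Implicit Types (F : GLpQ -> gform R) (f : gform R) (a b g : GLpQ).

Let G1 : G 1%g. Proof. by case: hG. Qed.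
Let GM a b : G a -> G b -> G (a * b)%g. Proof. by case: hG => _ _ + _ _; apply. Qed.
Let GV a : G a -> G (a^-1)%g. Proof. by case: hG => _ _ _ + _; apply. Qed.

Lemma Mod_Mod_all : Mod R G `<=` @Mod_all R.
Proof. by case: hG => _ _ _ _ [N N0 NG] f fG; exists N => //; exact: ModS fG. Qed.

Lemma Mod0_Mod0_all : Mod0 R G `<=` @Mod0_all R.
Proof. by case: hG => _ _ _ _ [N N0 NG] f fG; exists N => //; exact: Mod0S fG. Qed.

Lemma hecke_mul_Mod_all F1 F2 a : (forall b, Mod_all (F1 b)) ->
  (forall b, Mod_all (F2 b)) -> Mod_all (hecke_mul G F1 F2 a).
Proof.
move=> F1M F2M; apply: coset_sum_ind => [|f h|b]; first exact/Mod0_all_sub/Mod0_all0.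
  exact: Mod_allD.
by apply: Mod_allM => //; exact: Mod_all_slash.
Qed.

Lemma hecke_mul_Mod0_all F1 F2 a :
  (forall b, Mod_all (F1 b)) -> (forall b, Mod_all (F2 b)) ->
  (forall b, Mod0_all (F1 b)) \/ (forall b, Mod0_all (F2 b)) ->
  Mod0_all (hecke_mul G F1 F2 a).
Proof.
move=> F1M F2M F0; apply: coset_sum_ind => [|f h|b]; first exact: Mod0_all0.
  exact: Mod0_allD.
rewrite /hecke_mul_term; case: F0 => F0; last first.
  by apply: Mod0_allM => //; exact: Mod0_all_slash.
(* Commutativity moves the cuspidal factor to the right, where [Mod0_allM] expects it. *)
by rewrite mulrC; apply: Mod0_allM => //; exact: Mod_all_slash.
Qed.

(** Invariance of [f] is right covariance of the constant family [f]; the claim is covariance of its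
    product with [F], taken at the identity. *)
Lemma hecke_act_invariant F f g : hecke_form G F -> Mod R G f -> G g ->
  gslash (hecke_act G F f) g = hecke_act G F f.
Proof.
move=> [_ FG fin FS] fG Gg.
have fr : right_covariant G (fun=> f).
  by move=> h a Gh; rewrite (gslash_invariant fG Gh).
(* The product with a constant family has the same value at [1 * g] and at [1], by conversion. *)
exact: esym (hecke_mul_right_covariant G1 GM GV fin FG FS fr 1%g Gg).
Qed.

(** The result is first modular for some [Gamma(N)]; its invariance then gives modularity for
    [G]. *)
Lemma hecke_act_Mod F f : hecke_form G F -> Mod R G f -> Mod R G (hecke_act G F f).
Proof.
move=> FG fG; have [N _ actN] : Mod_all (hecke_act G F f).
  apply: (@hecke_mul_Mod_all F (fun=> f) 1%g) => [b|_].
    exact: hecke_form_modular FG b.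
  exact: Mod_Mod_all.
by apply: Mod_invariant actN _ => g; exact: hecke_act_invariant.
Qed.

Lemma hecke_act_Mod0 F f : hecke_form G F -> Mod R G f ->
  (forall b, Mod0_all (F b)) \/ Mod0 R G f -> Mod0 R G (hecke_act G F f).
Proof.
move=> FG fG F0; have [N _ actN] : Mod0_all (hecke_act G F f).
  apply: (@hecke_mul_Mod0_all F (fun=> f) 1%g) => [b|_|].
  - exact: hecke_form_modular FG b.
  - exact: Mod_Mod_all.
  by case: F0 => [|/Mod0_Mod0_all]; [left|right].
by apply: Mod0_invariant actN _ => g; exact: hecke_act_invariant.
Qed.

Lemma hecke_form_linear (k : R[i]) F1 F2 :
  hecke_form G F1 -> hecke_form G F2 -> hecke_form G (k *: F1 + F2).
Proof.
move=> [F1M F1G fin1 F1S] [F2M F2G fin2 F2S]; split=> [a|g a Gg||g a Gg].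
- rewrite hecke_linE; apply: Mod_allD => //.
  by apply: Mod_allM => //; exact: Mod_all_cst.
- by rewrite !hecke_linE F1G // F2G.
- apply: sub_finite_set (@coset_support_linear _ _ _ _ _) _.
  by rewrite finite_setU.
by rewrite !hecke_linE gslashD gslashM gslash_cst F1S // F2S.
Qed.

Lemma hecke_form0 : hecke_form G (0 : GLpQ -> gform R).
Proof.
split=> [a|//||g a _]; first exact/Mod0_all_sub/Mod0_all0.
  rewrite (_ : [set a | _] = set0) ?image_set0 //.
  by apply/seteqP; split=> // a /=; rewrite eqxx.
by rewrite gslash0.
Qed.

Lemma hecke_form_mul F1 F2 :
  hecke_form G F1 -> hecke_form G F2 -> hecke_form G (hecke_mul G F1 F2).
Proof.
move=> [F1M F1G fin1 F1S] [F2M F2G fin2 F2S]; split.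
- by move=> a; exact: hecke_mul_Mod_all.
- exact: hecke_mul_left_invariant.
- apply: (@sub_finite_set _ _ (product_support G F1 F2)).
    exact: hecke_mul_support.
  exact: product_support_finite.
exact: hecke_mul_right_covariant.
Qed.

Lemma hecke_form_one : hecke_form G (hecke_one R G).
Proof.
split.
- by rewrite /hecke_one => a; case: ifP => _; [exact: (Mod_all_cst 1)|exact: (Mod_all_cst 0)].
- exact: hecke_one_left_invariant.
- apply: (@sub_finite_set _ _ [set gcoset G 1%g]) => // _ [a /hecke_one_neq0 Ga <-] /=.
  by rewrite -[a]mulg1 gcosetMl.
exact: hecke_one_right_covariant.
Qed.

Lemma hecke_mul_term_summable F1 F2 a :
  hecke_form G F1 -> right_covariant G F2 ->
  coset_summable G (hecke_mul_term F1 F2 a).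
Proof.
move=> [_ F1G fin1 _] F2S; split; first exact: hecke_mul_term_left_invariant.
exact: sub_finite_set (@hecke_mul_term_support _ _ _ _ _) fin1.
Qed.

End HeckeForms.

(** * The algebra, its module and the cuspidal ideal *)

Theorem proposition2 (R : realType) (Gamma : set GLpQ)
    (hGamma : congruence_subgroup Gamma) :
  exists e : GLpQ -> gform R,
  [/\ (forall (F1 F2 : GLpQ -> gform R) (a : GLpQ),
         heckeA R Gamma F1 -> heckeA R Gamma F2 ->
         coset_summable Gamma (hecke_mul_term F1 F2 a)) /\
      assoc_algebra (heckeA R Gamma) (hecke_mul Gamma) e,
      (forall (F : GLpQ -> gform R) (f : gform R),
         heckeA R Gamma F -> Mod R Gamma f ->
         coset_summable Gamma (hecke_act_term F f)) /\
      algebra_module (heckeA R Gamma) (hecke_mul Gamma) e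
        (Mod R Gamma) (hecke_act Gamma)
    & [/\ algebra_ideal (heckeA R Gamma) (hecke_mul Gamma) (heckeA0 R Gamma),
          algebra_submodule (heckeA R Gamma) (Mod R Gamma) (hecke_act Gamma)
            (Mod0 R Gamma)
        & forall (F : GLpQ -> gform R) (f : gform R),
            heckeA0 R Gamma F -> Mod R Gamma f ->
            Mod0 R Gamma (hecke_act Gamma F f)]].
Proof.
have [_ G1 GM GV _] := hGamma.
have constr f : Mod R Gamma f -> right_covariant Gamma (fun=> f).
  by move=> fG g a Gg; rewrite (gslash_invariant fG Gg).
have actE F f : hecke_act Gamma F f = hecke_mul Gamma F (fun=> f) 1%g by [].
have subA : Defs.subspace (heckeA R Gamma).
  split=> [|k F1 F2]; [exact: hecke_form0|exact: hecke_form_linear].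
have subM : Defs.subspace (Mod R Gamma).
  split=> [|k f h fG hG]; first exact/Mod0_sub/Mod0_0.
  by rewrite gform_scaleE; apply: ModD => //; apply: ModM => //; exact: Mod_cst.
exists (hecke_one R Gamma); split; [split|split|split].
- by move=> F1 F2 a AF1 [_ _ _ F2S]; exact: hecke_mul_term_summable.
- split=> //.
  + by move=> F1 F2; exact: hecke_form_mul.
  + by move=> k F1 F2 F3 [_ _ fin1 _] [_ _ fin2 _] _; exact: hecke_mul_linearl.
  + by move=> k F1 F2 F3 _ _ [_ _ fin3 _]; exact: hecke_mul_linearr.
  + by move=> F1 F2 F3 [_ _ fin1 _] [_ F2G fin2 _] [_ _ _ F3S]; exact: hecke_mulA.
  + exact: hecke_form_one.
  + by move=> F [_ _ _ FS]; exact: hecke_mul1.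
  by move=> F [_ FG _ _]; exact: hecke_mulr1.
- move=> F f AF /constr fS.
  exact: (hecke_mul_term_summable hGamma 1%g AF fS).
- split=> //.
  + by move=> F f; exact: hecke_act_Mod.
  + move=> k F1 F2 f [_ _ fin1 _] [_ _ fin2 _] _.
    by rewrite !actE hecke_mul_linearl // hecke_linE gform_scaleE.
  + move=> k F f h [_ _ fin _] _ _.
    (* Linearity in the form is linearity in the constant family. *)
    rewrite !actE (_ : (fun=> _) = k *: (fun=> f) + (fun=> h)) //.
    by rewrite hecke_mul_linearr // hecke_linE gform_scaleE.
  + move=> F1 F2 f [_ _ fin1 _] [_ F2G fin2 _] /constr fS.
    (* The product of [F2] with the constant family [f] is again constant, with value [F2 * f], so
       associativity at the identity is the module law. *)
    exact: (congr1 (@^~ 1%g) (hecke_mulA G1 GM GV fin1 fin2 F2G fS)).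
  by move=> f /constr fS; exact: (congr1 (@^~ 1%g) (hecke_mul1 G1 GM GV fS)).
- split.
  + by move=> F [].
  + split=> [|k F1 F2 [AF1 F1C] [AF2 F2C]].
      by split; [exact: hecke_form0|move=> a; exact: Mod0_all0].
    split; first exact: hecke_form_linear.
    move=> a; rewrite hecke_linE; apply: Mod0_allD => //.
    by apply: Mod0_allM => //; exact: Mod_all_cst.
  + move=> F1 F2 AF1 [AF2 F2C]; split; first exact: hecke_form_mul.
    move=> a; apply: hecke_mul_Mod0_all; [exact: hecke_form_modular AF1|
      exact: hecke_form_modular AF2|by right].
  move=> F1 F2 [AF1 F1C] AF2; split; first exact: hecke_form_mul.
  move=> a; apply: hecke_mul_Mod0_all; [exact: hecke_form_modular AF1|
    exact: hecke_form_modular AF2|by left].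
- split.
  + exact: Mod0_sub.
  + split=> [|k f h fG hG]; first exact: Mod0_0.
    by rewrite gform_scaleE; apply: Mod0D => //; apply: Mod0M => //; exact: Mod_cst.
  by move=> F f AF fG; apply: hecke_act_Mod0 => //; [exact: Mod0_sub|right].
by move=> F f [AF FC] fG; apply: hecke_act_Mod0 => //; left.
Qed.
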